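(* Let $n$ be a positive integer, let $w_1,w_2,\dots,w_n\in\mathbb{N}$ be positive integers, let $m\ge 0$ be an integer and let $x\in\mathbb{Z}_p$. For a permutation $\sigma$ in the symmetric group $S_n$ of degree $n$, put $W_\sigma=w_{\sigma(1)}w_{\sigma(2)}\cdots w_{\sigma(n-1)}$. Then the expression $$\sum_{r=0}^m\sum_{s=0}^r\binom{r}{s}S_1(m,r)\,\lambda^{m-r}\,[W_\sigma]_q^{\,s-1}\,[w_{\sigma(n)}]_q^{\,r-s}\,\beta_{s,\,q^{W_\sigma}}\big(w_{\sigma(n)}x\big)\,K_{n,\,q^{w_{\sigma(n)}}}\big(w_{\sigma(1)},\dots,w_{\sigma(n-1)}\,\big|\,r-s,\,s\big)$$ takes the same value for every permutation $\sigma\in S_n$.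
   Context: Let $p$ be a fixed odd prime, $\mathbb{Z}_p$ the ring of $p$-adic integers, and $\mathbb{C}_p$ the completion of the algebraic closure of $\mathbb{Q}_p$, with norm normalized by $|p|_p=1/p$. Let $q\in\mathbb{C}_p$, $q\ne1$, with $|1-q|_p<p^{-1/(p-1)}$, and let $\lambda\in\mathbb{C}_p$ with $\lambda\neq 0$, $|\lambda|_p\le 1$. For $Q\in\mathbb{C}_p$, $Q\ne1$, $|1-Q|_p<p^{-1/(p-1)}$, and $a\in\mathbb{Z}_p$, write $Q^a=\exp(a\log Q)$ and $[a]_Q=\frac{1-Q^a}{1-Q}$. $S_1(m,r)$ denotes the (signed) Stirling numbers of the first kind: $X(X-1)\cdots(X-m+1)=\sum_{r=0}^m S_1(m,r)X^r$. Carlitz's $q$-Bernoulli numbers $\beta_{l,Q}$ are defined by $\beta_{0,Q}=1$ and, for $k\ge1$, $Q\sum_{l=0}^k\binom{k}{l}Q^l\beta_{l,Q}-\beta_{k,Q}=1$ if $k=1$ and $=0$ if $k>1$. Carlitz's $q$-Bernoulli polynomials are $\beta_{k,Q}(a)=\sum_{l=0}^k\binom{k}{l}Q^{la}\beta_{l,Q}[a]_Q^{k-l}$. Equivalently, $\beta_{k,Q}(a)=\lim_{N\to\infty}\frac{1}{[p^N]_Q}\sum_{y=0}^{p^N-1}[a+y]_Q^k\,Q^y$. For positive integers $v_1,\dots,v_{n-1}$ and integers $i,u\ge0$, $$K_{n,Q}(v_1,\dots,v_{n-1}\,|\,i,u)=\sum_{k_1=0}^{v_1-1}\cdots\sum_{k_{n-1}=0}^{v_{n-1}-1}Q^{(u+1)\sum_{j=1}^{n-1}\left(\prod_{1\le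 h\le n-1,\,h\ne j}v_h\right)k_j}\left[\sum_{j=1}^{n-1}\Big(\prod_{1\le h\le n-1,\,h\neq j}v_h\Big)k_j\right]_Q^{\,i},$$ where a zeroth power equals $1$ (including $0^0=1$). Empty products equal $1$, empty sums inside exponents and brackets equal $0$, and for $n=1$ the iterated sum has a single term. *)

(* Defs.v *)
From mathcomp Require Export all_boot all_order all_algebra all_fingroup.
From mathcomp Require Export all_classical all_reals all_analysis.

Set Implicit Arguments.
Unset Strict Implicit.
Unset Printing Implicit Defensive.

Export Order.TTheory GRing.Theory Num.Theory.
Export numFieldNormedType.Exports.

Local Open Scope classical_set_scope.
Local Open Scope ring_scope.

Section UltrametricSpace.
Variables (R : realType) (C : fieldType) (norm : C -> R).

Definition norm_cvg (u : nat -> C) (l : C) : Prop :=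
  norm (u k - l) @[k --> \oo] --> (0 : R).

Definition norm_lim (u : nat -> C) : C := xget 0 [set l | norm_cvg u l].

Definition norm_cauchy (u : nat -> C) : Prop :=
  forall e : R, 0 < e -> exists N, forall j k,
    (N <= j)%N -> (N <= k)%N -> norm (u j - u k) < e.

Definition norm_complete : Prop :=
  forall u, norm_cauchy u -> exists l, norm_cvg u l.

Definition norm_closure (A : set C) : set C :=
  [set z | forall e : R, 0 < e -> exists2 y, A y & norm (z - y) < e].

(* In a complete valued field whose absolute value extends the p-adic one,
   the closures of the images of Z and Q are Z_p and Q_p.                  *)
Definition padic_int : set C := norm_closure (range (fun k : int => k%:~R)).
Definition padic_rat : set C := norm_closure (range (@ratr C)).

Definition padic_alg : set C := [set z | exists P : {poly C},
  [/\ forall i, padic_rat P`_i, P != 0 & root P z]].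

End UltrametricSpace.

(* MathComp's norm `|_| satisfies `|x *+ n| = `|x| *+ n, which fails for a
   p-adic absolute value, so the latter is a field of the record.
   The axioms say that C is a completion of an algebraic closure of Q_p, with
   |p| = 1/p: it is complete, and the subfield of elements algebraic over Q_p
   is algebraically closed and dense.                                        *)
Record padicComplex (R : realType) (p : nat) := PadicComplex {
  padic_field :> fieldType;
  padic_norm : padic_field -> R;
  padic_norm_ge0 : forall z, 0 <= padic_norm z;
  padic_norm_eq0 : forall z, (padic_norm z == 0) = (z == 0);
  padic_normM : forall y z, padic_norm (y * z) = padic_norm y * padic_norm z;
  padic_norm_ultra : forall y z,
    padic_norm (y + z) <= Num.max (padic_norm y) (padic_norm z);
  padic_norm_p : padic_norm p%:R = p%:R^-1;
  padic_norm_complete : norm_complete padic_norm;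
  padic_alg_closed : forall P : {poly padic_field},
    (forall i, padic_alg padic_norm P`_i) -> (1 < size P)%N ->
    exists2 z, padic_alg padic_norm z & root P z;
  padic_alg_dense : norm_closure padic_norm (padic_alg padic_norm) = setT
}.
Arguments padic_norm {R p C} z : rename.

Definition stirling1 (m r : nat) : int :=
  (\prod_(k < m) ('X - k%:R%:P) : {poly int})`_r.

Section QAnalogues.
Variables (R : realType) (p : nat) (C : padicComplex R p).
Implicit Types (Q a z : C) (k l : nat).

Definition padic_exp z : C := norm_lim padic_norm (series (fun k => z ^+ k / k`!%:R)).

Definition padic_log z : C :=
  norm_lim padic_norm (series (fun k => (-1) ^+ k * (z - 1) ^+ k.+1 / k.+1%:R)).

Definition qpow Q a : C := padic_exp (a * padic_log Q).

Definition qnum Q a : C := (1 - qpow Q a) / (1 - Q).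

Definition carlitz_spec Q (b : nat -> C) : Prop :=
  b 0%N = 1 /\
  forall k, (0 < k)%N ->
    Q * (\sum_(l < k.+1) 'C(k, l)%:R * qpow Q l%:R * b l) - b k
    = (k == 1%N)%:R.

(* The recursion determines b when 0 < |1 - Q| < p^(-1/(p-1)). *)
Definition carlitz_num Q : nat -> C := xget (fun=> 0) (carlitz_spec Q).

Definition carlitz_poly k Q a : C :=
  \sum_(l < k.+1) 'C(k, l)%:R * qpow Q (l%:R * a) * carlitz_num Q l
                  * qnum Q a ^+ (k - l).

(* K_{d+1,Q}(v_1, ..., v_d | i, u); the iterated sum runs over the dependent
   functions k with k j < v j.                                               *)
Definition qK (d : nat) Q (v : 'I_d -> nat) (i u : nat) : C :=
  \sum_(k : {dffun forall j : 'I_d, 'I_(v j)})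
    let e := (\sum_(j < d) (\prod_(h < d | h != j) v h) * k j)%N in
    qpow Q (u.+1 * e)%N%:R * qnum Q e%:R ^+ i.

(* With n.+1 weights w_0, ..., w_n; [widen_ord (leqnSn n)] embeds the first n
   indices and [ord_max] is the last one. The exponent s - 1 may be -1.       *)
Definition carlitz_sum (n : nat) (w : 'I_n.+1 -> nat) (m : nat) (q lambda x : C)
    (sigma : 'S_n.+1) : C :=
  let v := fun j : 'I_n => w (sigma (widen_ord (leqnSn n) j)) in
  let wn := w (sigma ord_max) in
  let W := (\prod_(j < n) v j)%N in
  \sum_(r < m.+1) \sum_(s < r.+1)
    'C(r, s)%:R * (stirling1 m r)%:~R * lambda ^+ (m - r)
    * qnum q W%:R ^ (s%:Z - 1) * qnum q wn%:R ^+ (r - s)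
    * carlitz_poly s (qpow q W%:R) (wn%:R * x)
    * qK (qpow q wn%:R) v (r - s) s.

End QAnalogues.

(* Main.v *)
(** Put L = log q and E(a) = q^a = exp(aL), so that q^(kl) = (q^k)^l holds because
    log (exp z) = z; the latter follows from log z = lim (z^(p^N) - 1) / p^N and
    exp(z)^(p^N) = exp(p^N z) = 1 + p^N z + O(p^(2N)). The closed form
      beta_{k,Q}(a) = (1-Q)^(-k) \sum_j C(k,j) (-1)^j Q^(ja) (j+1) (1-Q)/(1-Q^(j+1))
    turns the inner sum over s, for P = w_1 ... w_n, into
      (1-q)^(1-r) \sum_l C(r,l) (-1)^l q^(lPx) (l+1)
        (1 - q^((l+1)P))^(n-1) / \prod_j (1 - q^((l+1)P/w_j)),
    where all weights play the same role. *)
Require Import Defs.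
From mathcomp Require Import ring lra zify.

Set Implicit Arguments.
Unset Strict Implicit.
Unset Printing Implicit Defensive.

Local Open Scope classical_set_scope.
Local Open Scope ring_scope.

(** * Binomial sums *)

(** Both sides are the trinomial coefficient (j+i+t)! / (j! i! t!). Indices written as sums avoid
    truncated subtraction. *)
Lemma mul_bin_bin (i j t : nat) :
  ('C(j + i + t, j + i) * 'C(j + i, j) = 'C(j + i + t, j) * 'C(i + t, i))%N.
Proof.
have f a b : ('C(a + b, a) * (a`! * b`!) = (a + b)`!)%N.
  by have := bin_fact (leq_addr b a); rewrite addKn.
have posM := (muln_gt0, fact_gt0).
apply/eqP; rewrite -(eqn_pmul2r (_ : 0 < j`! * i`! * t`!)%N) ?posM//; apply/eqP.
have h1 := f (j + i)%N t; have h2 := f j i; have h3 := f j (i + t)%N.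
have h4 := f i t; rewrite addnA -h1 -h2 -h4 in h3.
by rewrite mulnACA mulnAC -!mulnA in h3 *; lia.
Qed.

(** After exchanging the sums, C(k,l) C(l,j) = C(k,j) C(k-j,l-j) turns the sum over l into the
    binomial expansion of (x+y)^(k-j). Every later use has x + y = 1, so this power disappears. *)
Lemma sum_bin_transform (K : comNzRingType) (x y : K) (f : nat -> K) k :
  \sum_(l < k.+1) 'C(k, l)%:R * x ^+ l * y ^+ (k - l)
                  * (\sum_(j < l.+1) 'C(l, j)%:R * f j)
  = \sum_(j < k.+1) 'C(k, j)%:R * f j * x ^+ j * (x + y) ^+ (k - j).
Proof.
transitivity (\sum_(l < k.+1) \sum_(j < k.+1)
   'C(k, l)%:R * x ^+ l * y ^+ (k - l) * ('C(l, j)%:R * f j)).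
  apply: eq_bigr => l _; rewrite -mulr_sumr; congr (_ * _).
  rewrite (big_ord_widen k.+1 (fun j => 'C(l, j)%:R * f j)) ?ltn_ord//.
  rewrite [RHS](bigID (fun j : 'I_k.+1 => (j < l.+1)%N)) /=.
  by rewrite [X in _ + X]big1 ?addr0// => j; rewrite -leqNgt => /bin_small ->;
    rewrite mulr0n mul0r.
rewrite exchange_big; apply: eq_bigr => -[j /= jk] _.
rewrite addrC exprDn mulr_sumr.
rewrite -(big_mkord predT (fun l => 'C(k, l)%:R * x ^+ l * y ^+ (k - l) * ('C(l, j)%:R * f j))).
(* Terms with l < j vanish because C(l,j) = 0; the others are reindexed by l = i + j. *)
rewrite (big_cat_nat (n := j)) ?(ltnW jk)//= big_nat big1 ?add0r; last first.
  by move=> l /andP[_ lj]; rewrite [X in _ * (X%:R * _)]bin_small// mulr0n mul0r mulr0.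
rewrite -{1}(add0n j) big_addn subSn// big_mkord; apply: eq_bigr => -[i /= ik] _.
have [t ->] : exists t, k = (j + i + t)%N by exists (k - j - i)%N; lia.
rewrite (addnC i j) addKn -[X in (X - j)%N]addnA addKn addKn -mulr_natr exprD.
have /(congr1 (fun z => z%:R : K)) := mul_bin_bin i j t; rewrite !natrM => h.
transitivity ('C(j + i + t, j + i)%:R * 'C(j + i, j)%:R * (f j * x ^+ j * (y ^+ t * x ^+ i)));
  first ring.
by rewrite h; ring.
Qed.

(** This is the derivative of X (1+X)^(k+1) at X = -1. It produces the right-hand side of the
    Carlitz recursion. *)
Lemma sum_bin_sign (K : comNzRingType) k :
  \sum_(j < k.+2) 'C(k.+1, j)%:R * (-1) ^+ j * j.+1%:R = - (k == 0)%:R :> K.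
Proof.
have e n : \sum_(j < n.+1) 'C(n, j)%:R * (-1) ^+ j = (n == 0)%:R :> K.
  transitivity ((1 + (-1)) ^+ n : K); last by rewrite subrr expr0n.
  by rewrite exprDn; apply: eq_bigr => j _; rewrite expr1n mul1r mulr_natl.
under eq_bigr do rewrite -natr1 mulrDr mulr1.
rewrite big_split /= e addr0 big_ord_recl /= mulr0 add0r.
transitivity (- (k.+1%:R * \sum_(j < k.+1) 'C(k, j)%:R * (-1) ^+ j) : K).
  rewrite mulr_sumr -sumrN; apply: eq_bigr => j _.
  rewrite /bump /= add1n exprS.
  have /(congr1 (fun z => z%:R : K)) := mul_bin_diag k.+1 j; rewrite !natrM /= => h.
  transitivity (- (j.+1%:R * 'C(k.+1, j.+1)%:R) * (-1) ^+ j : K); first by ring.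
  by rewrite -h; ring.
by rewrite e; case: k => [|k]; rewrite ?mulr1 ?mulr0.
Qed.

(** Distributivity when the range of summation depends on the factor, as in [qK]. Passing through
    [fprod] and tagged elements puts all the ranges into one type. *)
Lemma big_distr_dffun (K : comNzRingType) (I : finType) (T_ : I -> finType)
    (P : forall i : I, T_ i -> K) :
  \sum_(t : {dffun forall i, T_ i}) \prod_i P i (t i) = \prod_i \sum_(j : T_ i) P i j.
Proof.
pose P' i : {ffun T_ i -> K} := [ffun j => P i j].
transitivity (\sum_(t : fprod T_) \prod_i P' i (t i)).
  rewrite (reindex (@fprod_of_dffun I T_)); last first.
    exact/onW_bij/fprod_of_dffun_bij.
  by apply: eq_bigr => t _; apply: eq_bigr => i _; rewrite ffunE fprodE.
transitivity (\prod_i \sum_(j in tagged_with T_ i) untag 0 (P' i) j).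
  by rewrite big_fprod bigA_distr_big_dep.
apply: eq_bigr => i _.
by rewrite -(big_tag (fun i j => P' i j)); apply: eq_bigr => j _; rewrite ffunE.
Qed.

(** * The p-adic norm *)

Section PadicAnalysis.
Variables (R : realType) (p : nat) (C : padicComplex R p).
Implicit Types (x y z l : C) (u v : nat -> C).
Local Notation norm := (@padic_norm R p C).

Lemma padic_norm0 : norm 0 = 0.
Proof. by apply/eqP; rewrite padic_norm_eq0. Qed.

Lemma padic_norm_gt0 z : (0 < norm z) = (z != 0).
Proof. by rewrite lt_neqAle eq_sym padic_norm_eq0 padic_norm_ge0 andbT. Qed.

Lemma padic_norm1 : norm 1 = 1.
Proof.
have n0 : norm 1 != 0 by rewrite padic_norm_eq0 oner_eq0.
by apply: (mulfI n0); rewrite -padic_normM !mulr1.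
Qed.

Lemma padic_normX z k : norm (z ^+ k) = norm z ^+ k.
Proof. by elim: k => [|k IH]; rewrite ?expr0 ?padic_norm1// !exprS padic_normM IH. Qed.

Lemma padic_normV z : norm z^-1 = (norm z)^-1.
Proof.
have [->|z0] := eqVneq z 0; first by rewrite invr0 padic_norm0 invr0.
have n0 : norm z != 0 by rewrite padic_norm_eq0.
by apply: (mulfI n0); rewrite -padic_normM !divff// padic_norm1.
Qed.

Lemma padic_normN z : norm (- z) = norm z.
Proof.
have h : norm (-1) = 1.
  apply/eqP; rewrite -(@eqrXn2 _ 2) ?padic_norm_ge0//.
  by rewrite -padic_normX sqrrN expr1n padic_norm1 expr1n.
by rewrite -mulN1r padic_normM h mul1r.
Qed.

Lemma padic_norm_distC x y : norm (x - y) = norm (y - x).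
Proof. by rewrite -padic_normN opprB. Qed.

Lemma padic_normD_le x y (B : R) : norm x <= B -> norm y <= B -> norm (x + y) <= B.
Proof. by move=> xB yB; rewrite (le_trans (padic_norm_ultra _ _))// ge_max xB. Qed.

Lemma padic_normB_le x y (B : R) : norm x <= B -> norm y <= B -> norm (x - y) <= B.
Proof. by move=> xB yB; apply: padic_normD_le; rewrite ?padic_normN. Qed.

Lemma padic_norm_sum_le (I : Type) (r : seq I) (P : pred I) (F : I -> C) (B : R) :
  0 <= B -> (forall i, P i -> norm (F i) <= B) -> norm (\sum_(i <- r | P i) F i) <= B.
Proof.
move=> B0 FB; elim/big_ind : _ => //; first by rewrite padic_norm0.
by move=> x y; apply: padic_normD_le.
Qed.

Lemma padic_norm_nat_le1 k : norm k%:R <= 1.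
Proof.
elim: k => [|k IH]; first by rewrite padic_norm0.
by rewrite -natr1 padic_normD_le// padic_norm1.
Qed.

Lemma padic_norm_int_le1 (k : int) : norm k%:~R <= 1.
Proof. by case: k => k; rewrite ?NegzE ?mulrNz ?padic_normN padic_norm_nat_le1. Qed.

(** Some integer lies at distance less than 1 from x, and integers have norm at most 1. *)
Lemma padic_int_norm_le1 x : padic_int norm x -> norm x <= 1.
Proof.
move=> /(_ 1 ltr01)[_ [k _ <-] xk].
rewrite -(subrK k%:~R x) padic_normD_le ?(ltW xk)//; exact: padic_norm_int_le1.
Qed.

(** * Norms of natural numbers and factorials *)

Hypothesis p_prime : prime p.

Let p_gt0 : 0 < p%:R :> R.
Proof. by rewrite ltr0n prime_gt0. Qed.

Lemma invp_itv : 0 <= (p%:R^-1 : R) < 1.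
Proof. by rewrite invr_ge0 ler0n invf_lt1// ltr1n prime_gt1. Qed.

(** A Bezout relation 1 = a k - b p with |k| < 1 would force |1| < 1. *)
Lemma padic_norm_coprime k : coprime p k -> norm k%:R = 1.
Proof.
move=> pk; apply/eqP; rewrite eq_le padic_norm_nat_le1 /= leNgt; apply/negP => k1.
have k0 : (0 < k)%N by case: k pk {k1} => //; rewrite /coprime gcdn0 => /eqP p1; move: p_prime;
  rewrite p1.
have [a b ab _] := egcdnP p k0.
have : norm 1 < 1; last by rewrite padic_norm1 ltxx.
have -> : 1 = (a * k)%:R - (b * p)%:R :> C.
  by rewrite ab gcdnC (eqP pk) natrD addrAC subrr add0r.
apply: le_lt_trans (padic_norm_ultra _ _) _; rewrite gt_max padic_normN !natrM !padic_normM.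
apply/andP; split.
  by rewrite (le_lt_trans _ k1)// ler_piMl ?padic_norm_ge0// padic_norm_nat_le1.
rewrite padic_norm_p (@le_lt_trans _ _ p%:R^-1)//.
  by rewrite ler_piMl ?invr_ge0 ?padic_norm_nat_le1// ltW.
by rewrite invf_lt1// ltr1n prime_gt1.
Qed.

Lemma padic_norm_natE k : (0 < k)%N -> norm k%:R = p%:R ^- logn p k.
Proof.
move=> k0; have [m pm {1}->] := pfactor_coprime p_prime k0.
by rewrite natrM natrX padic_normM padic_norm_coprime// mul1r padic_normX padic_norm_p exprVn.
Qed.

Lemma padic_norm_nat_gt0 k : (0 < k)%N -> 0 < norm k%:R.
Proof. by move=> k0; rewrite padic_norm_natE// invr_gt0 exprn_gt0. Qed.

Lemma padic_nat_neq0 k : (0 < k)%N -> k%:R != 0 :> C.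
Proof. by move=> k0; rewrite -padic_norm_gt0 padic_norm_nat_gt0. Qed.

Lemma padic_norm_natV_le k : (0 < k)%N -> (norm k%:R)^-1 <= k%:R.
Proof.
move=> k0; rewrite padic_norm_natE// invrK -natrX ler_nat.
by rewrite dvdn_leq// pfactor_dvdnn.
Qed.

(** A consequence of Legendre's formula: (p-1) v((k+1)!) is k+1 minus a base-p digit sum, and that
    digit sum is at least 1. *)
Lemma logn_fact_bound k : (p.-1 * logn p k.+1`! <= k)%N.
Proof.
have p1 := prime_gt1 p_prime.
rewrite logn_fact// big_add1 /=.
(* Telescoping with p floor(a/p) <= a; the remaining quotient is kept on the left so that it can
   yield the strict bound. *)
have tele t : (p.-1 * \sum_(0 <= i < t) k.+1 %/ p ^ i.+1 + k.+1 %/ p ^ t <= k.+1)%N.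
  elim: t => [|t IH]; first by rewrite big_nil muln0 divn1.
  rewrite big_nat_recr//= mulnDr; apply: leq_trans IH.
  rewrite -addnA leq_add2l -mulSnr prednK ?prime_gt0// expnSr divnMA mulnC.
  exact: leq_divM.
(* Induction on the number of quotients: a zero last quotient is dropped, a positive one improves
   k+1 to k through [tele]. *)
elim: {-2}k.+1 => [|t IH]; first by rewrite big_nil muln0.
have := tele t.+1; rewrite big_nat_recr//=.
by have [->|] := posnP (k.+1 %/ p ^ t.+1); rewrite ?addn0 //; lia.
Qed.

(* The common radius of convergence of exp(z) and log(1 + z). *)
Definition exp_radius : R := p%:R `^ (- (p%:R - 1)^-1).
Local Notation rad := exp_radius.

Lemma exp_radius_gt0 : 0 < rad.
Proof. exact: powR_gt0. Qed.

Lemma exp_radiusX : rad ^+ p.-1 = p%:R^-1.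
Proof.
rewrite -powR_mulrn ?ltW ?exp_radius_gt0// -powRrM -subn1 natrB ?prime_gt0//.
rewrite mulNr mulVf ?powR_inv1 ?ltW//.
by rewrite subr_eq0 pnatr_eq1 gtn_eqF ?prime_gt1.
Qed.

Lemma exp_radius_lt1 : rad < 1.
Proof.
rewrite ltNge; apply/negP => /(exprn_ege1 p.-1); rewrite exp_radiusX.
by rewrite invf_ge1// (ler_nat _ p 1) leqNgt prime_gt1.
Qed.

(** Since [rad] to the power p-1 is 1/p, the norm of (k+1)! is a power of [rad], with exponent at
    most k by [logn_fact_bound]. *)
Lemma exp_radius_fact k : rad ^+ k <= norm k.+1`!%:R.
Proof.
rewrite padic_norm_natE ?fact_gt0// -exprVn -exp_radiusX -exprM.
by rewrite ler_wiXn2l ?logn_fact_bound// ltW ?exp_radius_lt1 ?exp_radius_gt0.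
Qed.

Lemma exp_radius_nat k : rad ^+ k <= norm k.+1%:R.
Proof.
rewrite (le_trans (exp_radius_fact k))// factS natrM padic_normM.
by rewrite ler_piMr ?padic_norm_ge0 ?padic_norm_nat_le1.
Qed.

(** * Limits and series for the p-adic norm *)

Lemma norm_cvgP u l : norm_cvg norm u l <->
  forall e : R, 0 < e -> exists N, forall k, (N <= k)%N -> norm (u k - l) < e.
Proof.
split=> [/cvgrPdist_lt h e /h[N _ hN]|h].
  by exists N => k /hN /=; rewrite sub0r normrN ger0_norm ?padic_norm_ge0.
apply/cvgrPdist_lt => e /h[N hN]; exists N => // k /= /hN.
by rewrite sub0r normrN ger0_norm ?padic_norm_ge0.
Qed.

Lemma norm_cvg_unique u l l' : norm_cvg norm u l -> norm_cvg norm u l' -> l = l'.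
Proof.
move=> /norm_cvgP h /norm_cvgP h'; apply/eqP; rewrite -subr_eq0 -[_ == _]negbK.
rewrite -padic_norm_gt0; apply/negP => d0.
have [N hN] := h _ d0; have [N' hN'] := h' _ d0.
suff : norm (l - l') < norm (l - l') by rewrite ltxx.
rewrite -{1}(subrKA (u (maxn N N'))) (le_lt_trans (padic_norm_ultra _ _))//.
by rewrite gt_max (padic_norm_distC l (u _)) hN ?leq_maxl// hN' ?leq_maxr.
Qed.

Lemma norm_limE u l : norm_cvg norm u l -> norm_lim norm u = l.
Proof.
move=> ul; apply: norm_cvg_unique (ul).
by have : [set l | norm_cvg norm u l] (norm_lim norm u) by apply: xgetPex; exists l.
Qed.

(** Closed balls are closed: if the limit left the ball, the ultrametric inequality through a late
    term would make |l - z| smaller than itself. *)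
Lemma norm_cvg_le u l z N (B : R) : norm_cvg norm u l ->
  (forall k, (N <= k)%N -> norm (u k - z) <= B) -> norm (l - z) <= B.
Proof.
move=> /norm_cvgP ul uz; rewrite leNgt; apply/negP => Bl.
have d0 : 0 < norm (l - z) by apply: le_lt_trans Bl; apply: le_trans (uz N _);
  rewrite ?padic_norm_ge0.
have [N' hN'] := ul _ d0.
suff : norm (l - z) < norm (l - z) by rewrite ltxx.
rewrite -{1}(subrKA (u (maxn N N'))) (le_lt_trans (padic_norm_ultra _ _))//.
rewrite gt_max (padic_norm_distC l (u _)) hN' ?leq_maxr//=.
by apply: le_lt_trans Bl; rewrite uz ?leq_maxl.
Qed.

Lemma norm_cvg_geo u (c rho : R) : 0 <= rho < 1 ->
  (forall k, norm (u k) <= c * rho ^+ k) -> norm_cvg norm u 0.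
Proof.
move=> /andP[rho0 rho1] uc.
have c0 : (fun k => c * rho ^+ k) @ \oo --> (0 : R).
  have h : `|rho| < 1 by rewrite ger0_norm.
  have := cvgM (cvg_cst c) (cvg_expr h); rewrite mulr0; exact.
apply: (squeeze_cvgr _ (cvg_cst 0) c0); near=> k.
by rewrite subr0 padic_norm_ge0 uc.
Unshelve. all: by end_near. Qed.

Lemma norm_cvg_close u v l : norm_cvg norm u l ->
  norm_cvg norm (fun k => v k - u k) 0 -> norm_cvg norm v l.
Proof.
move=> /norm_cvgP ul /norm_cvgP uv; apply/norm_cvgP => e e0.
have [N hN] := ul _ e0; have [N' hN'] := uv _ e0.
exists (maxn N N') => k; rewrite geq_max => /andP[/hN h /hN'].
rewrite subr0 -(subrKA (u k) (v k) (- l)) => h'.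
by rewrite (le_lt_trans (padic_norm_ultra _ _))// gt_max h' h.
Qed.

Lemma norm_cvg_sub u l (f : nat -> nat) : (forall k, (k <= f k)%N) ->
  norm_cvg norm u l -> norm_cvg norm (u \o f) l.
Proof.
move=> kf /norm_cvgP ul; apply/norm_cvgP => e /ul[N hN].
by exists N => k Nk; rewrite /= hN// (leq_trans Nk).
Qed.

Lemma norm_cvgM_le1 u v l l' : (forall k, norm (u k) <= 1) -> norm l' <= 1 ->
  norm_cvg norm u l -> norm_cvg norm v l' ->
  norm_cvg norm (fun k => u k * v k) (l * l').
Proof.
move=> u1 l1 /norm_cvgP ul /norm_cvgP vl; apply/norm_cvgP => e e0.
have [N hN] := ul _ e0; have [N' hN'] := vl _ e0.
exists (maxn N N') => k; rewrite geq_max => /andP[/hN h /hN' h'].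
have -> : u k * v k - l * l' = u k * (v k - l') + l' * (u k - l) by ring.
rewrite (le_lt_trans (padic_norm_ultra _ _))// gt_max !padic_normM.
by apply/andP; split; [apply: le_lt_trans h' | apply: le_lt_trans h];
  rewrite ler_piMl ?padic_norm_ge0.
Qed.

(** By the ultrametric inequality a tail is bounded by any common bound on its terms, with no
    summation of the bounds. *)
Lemma series_tail_le u l n (B : R) : norm_cvg norm (series u) l ->
  (forall k, (n <= k)%N -> norm (u k) <= B) -> norm (l - series u n) <= B.
Proof.
move=> ul uB; apply: (norm_cvg_le (N := n) ul) => k nk.
rewrite sub_series_geq// big_nat_cond padic_norm_sum_le//.
  by rewrite (le_trans _ (uB n _))// padic_norm_ge0.
by move=> i /andP[/andP[ni _] _]; rewrite uB.
Qed.

(** In an ultrametric space, terms tending to 0 already make the partial sums Cauchy; completeness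
    gives the limit. *)
Lemma geo_series_cvg u (c rho : R) : 0 <= rho < 1 ->
  (forall k, norm (u k) <= c * rho ^+ k) -> exists l, norm_cvg norm (series u) l.
Proof.
move=> rho01 uc; apply: padic_norm_complete => e e0.
have /norm_cvgP/(_ e e0)[N hN] : norm_cvg norm u 0 by exact: norm_cvg_geo uc.
have half j k : (N <= j)%N -> (j <= k)%N -> norm (series u j - series u k) < e.
  move=> Nj jk; rewrite padic_norm_distC sub_series_geq// big_nat_cond.
  elim/big_ind : _ => [|x y xe ye|i /andP[/andP[ji _] _]]; first by rewrite padic_norm0.
    by rewrite (le_lt_trans (padic_norm_ultra _ _))// gt_max xe.
  by have := hN i; rewrite subr0 (leq_trans Nj ji); exact.
exists N => j k Nj Nk; have [jk|kj] := leqP j k; first exact: half.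
by rewrite padic_norm_distC half// ltnW.
Qed.

End PadicAnalysis.

(** * The p-adic exponential and logarithm *)

Section PadicExpLog.
Variables (R : realType) (p : nat) (C : padicComplex R p).
Implicit Types (x y z l : C) (u v : nat -> C).
Hypothesis p_prime : prime p.
Local Notation norm := (@padic_norm R p C).
Local Notation rad := (exp_radius R p).

Let exp_term z k := z ^+ k / k`!%:R.
Let log_term z k := (-1) ^+ k * (z - 1) ^+ k.+1 / k.+1%:R.

Let rad_gt0 : 0 < rad. Proof. exact: exp_radius_gt0. Qed.

Lemma norm_ratio_lt1 z : norm z < rad -> 0 <= norm z / rad < 1.
Proof. by move=> zr; rewrite divr_ge0 ?padic_norm_ge0 ?(ltW rad_gt0)//= ltr_pdivrMr ?mul1r. Qed.

(** Common estimate for exp, with a = (k+1)!, and for log, with a = k+1. The factor |z| is kept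
    apart because both functions are later compared with their linear term. *)
Let scaled_term_le z k (a : C) : rad ^+ k <= norm a ->
  norm (z ^+ k.+1 / a) <= norm z * (norm z / rad) ^+ k.
Proof.
move=> ka; have rk : 0 < rad ^+ k by rewrite exprn_gt0.
rewrite padic_normM padic_normV padic_normX exprS -mulrA.
rewrite ler_wpM2l ?padic_norm_ge0// expr_div_n ler_wpM2l ?exprn_ge0 ?padic_norm_ge0//.
by rewrite lef_pV2 ?posrE// (lt_le_trans rk).
Qed.

Let exp_term_leS z k : norm (exp_term z k.+1) <= norm z * (norm z / rad) ^+ k.
Proof. by apply: scaled_term_le; exact: exp_radius_fact. Qed.

Let exp_term_le z k : norm (exp_term z k) <= (norm z / rad) ^+ k.
Proof.
case: k => [|k]; first by rewrite /exp_term expr0 fact0 divr1 padic_norm1.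
rewrite (le_trans (exp_term_leS z k))// exprS ler_wpM2r//.
  by rewrite exprn_ge0// divr_ge0 ?padic_norm_ge0// ltW.
by rewrite ler_pdivlMr// ler_piMr ?padic_norm_ge0 ?ltW// exp_radius_lt1.
Qed.

Let exp_term_le1 z k : norm z < rad -> norm (exp_term z k) <= 1.
Proof.
move=> /norm_ratio_lt1/andP[r0 r1]; rewrite (le_trans (exp_term_le z k))//.
by rewrite exprn_ile1// ltW.
Qed.

Lemma padic_exp_cvg z : norm z < rad -> norm_cvg norm (series (exp_term z)) (padic_exp z).
Proof.
move=> zr; have [|l zl] := @geo_series_cvg R p C (exp_term z) 1 _ (norm_ratio_lt1 zr).
  by move=> k; rewrite mul1r.
by rewrite /padic_exp (norm_limE zl).
Qed.

Lemma padic_exp_sub1_le z : norm z < rad -> norm (padic_exp z - 1) <= norm z.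
Proof.
move=> zr; have -> : 1 = series (exp_term z) 1.
  by rewrite /series /= big_nat1 /exp_term expr0 fact0 divr1.
apply: series_tail_le (padic_exp_cvg zr) _ => -[//|k] _.
rewrite (le_trans (exp_term_leS z k))// ler_piMr ?padic_norm_ge0//.
by have /andP[r0 /ltW r1] := norm_ratio_lt1 zr; rewrite exprn_ile1.
Qed.

(** This is exp(az) = 1 + az + O(a^2), uniformly in z: each term of degree k >= 2 is a^k times a
    term of exp(z), which has norm at most 1. *)
Lemma padic_exp_scale_le (a : C) z : norm a <= 1 -> norm z < rad ->
  norm (padic_exp (a * z) - 1 - a * z) <= norm a ^+ 2.
Proof.
move=> a1 zr; have azr : norm (a * z) < rad.
  by rewrite padic_normM (le_lt_trans _ zr)// ler_piMl ?padic_norm_ge0.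
have -> : padic_exp (a * z) - 1 - a * z = padic_exp (a * z) - series (exp_term (a * z)) 2.
  rewrite /series /= big_nat_recr//= big_nat1 /exp_term expr0 expr1 !divr1.
  by rewrite opprD addrA.
apply: series_tail_le (padic_exp_cvg azr) _ => -[|[|k]]// _.
have -> : exp_term (a * z) k.+2 = a ^+ k.+2 * exp_term z k.+2.
  by rewrite /exp_term exprMn mulrA.
rewrite padic_normM padic_normX -[leRHS]mulr1.
rewrite ler_pM ?exprn_ge0 ?padic_norm_ge0 ?exp_term_le1//.
by rewrite ler_wiXn2l ?padic_norm_ge0.
Qed.

Let exp_termD x y k :
  exp_term (x + y) k = \sum_(i < k.+1) exp_term x i * exp_term y (k - i)%N.
Proof.
rewrite /exp_term addrC exprDn mulr_suml; apply: eq_bigr => -[i /= ik] _.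
have := congr1 (fun n => n%:R : C) (bin_fact (ik : (i <= k)%N)); rewrite !natrM => <-.
rewrite -mulr_natr; field.
by rewrite !padic_nat_neq0 ?fact_gt0 ?bin_gt0.
Qed.

(* Both partial products differ from the partial sum of the Cauchy product only
   by terms with i + j >= N, which are small by the ultrametric inequality. *)
Lemma padic_expD x y : norm x < rad -> norm y < rad ->
  padic_exp (x + y) = padic_exp x * padic_exp y.
Proof.
move=> xr yr.
have xyr : norm (x + y) < rad.
  by rewrite (le_lt_trans (padic_norm_ultra _ _))// gt_max xr.
(* The larger ratio serves as one geometric rate for both series. *)
pose rho := Num.max (norm x / rad) (norm y / rad).
have rho01 : 0 <= rho < 1.
  have /andP[x0 x1] := norm_ratio_lt1 xr; have /andP[y0 y1] := norm_ratio_lt1 yr.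
  by rewrite le_max x0 gt_max x1.
have le_rho z k : norm z / rad <= rho -> norm (exp_term z k) <= rho ^+ k.
  move=> zrho; rewrite (le_trans (exp_term_le z k))// lerXn2r ?nnegrE//.
    by rewrite divr_ge0 ?padic_norm_ge0// ltW.
  by case/andP: rho01.
have xrho k : norm (exp_term x k) <= rho ^+ k by rewrite le_rho// le_max lexx.
have yrho k : norm (exp_term y k) <= rho ^+ k by rewrite le_rho// le_max lexx orbT.
have sum_le1 z k : norm z < rad -> norm (series (exp_term z) k) <= 1.
  by move=> zr; rewrite padic_norm_sum_le// => i _; rewrite exp_term_le1.
apply: norm_cvg_unique (padic_exp_cvg xyr) _.
apply: norm_cvg_close.
  apply: norm_cvgM_le1 (padic_exp_cvg xr) (padic_exp_cvg yr) => [k|].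
    exact: sum_le1.
  rewrite -[padic_exp y]subr0.
  by apply: (norm_cvg_le (N := 0) (padic_exp_cvg yr)) => k _; rewrite subr0 sum_le1.
apply: (norm_cvg_geo (c := 1) rho01) => N /=; rewrite mul1r.
(* The diagonals i + j = k with k < N are resummed row by row, to be compared with the full N by N
   square. *)
have -> : series (exp_term (x + y)) N =
    \sum_(i < N) \sum_(j < N | (i + j < N)%N) exp_term x i * exp_term y j.
  pose g i j := exp_term x i * exp_term y j.
  have -> : series (exp_term (x + y)) N = \sum_(k < N) \sum_(i < N | (i <= k)%N) g i (k - i)%N.
    rewrite /series /= big_mkord; apply: eq_bigr => k _; rewrite exp_termD.
    by rewrite (big_ord_widen_cond N predT (fun i => g i (k - i)%N)).
  rewrite (exchange_big_dep predT)//=; apply: eq_bigr => i _.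
  rewrite -(big_mkord (fun k => i <= k)%N (fun k => g i (k - i)%N)).
  rewrite (big_cat_nat (n := i)) ?(ltnW (ltn_ord i))//= big_nat_cond big_pred0 ?add0r; last first.
    by move=> k; case: leqP => //; rewrite andbF.
  rewrite big_nat_cond -{1}(add0n (i : nat)) big_addn big_mkord.
  rewrite (@big_ord_widen_cond _ _ _ _ N (fun j => (i <= j + i < N) && (i <= j + i))%N
    (fun j => g i (j + i - i)%N)) ?leq_subr//.
  by apply: eq_big => [j|j _]; [apply/idP/idP; lia | rewrite addnK].
have -> : series (exp_term x) N * series (exp_term y) N =
    \sum_(i < N) \sum_(j < N) exp_term x i * exp_term y j.
  rewrite /series /= !big_mkord mulr_suml; apply: eq_bigr => i _.
  by rewrite mulr_sumr.
rewrite -sumrB padic_norm_sum_le ?exprn_ge0 ?(andP rho01).1// => i _.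
rewrite [X in _ - X](bigID (fun j : 'I_N => (i + j < N)%N)) /= opprD addNKr padic_normN.
rewrite padic_norm_sum_le ?exprn_ge0 ?(andP rho01).1// => j.
rewrite -leqNgt => Nij; rewrite padic_normM (@le_trans _ _ (rho ^+ (i + j)))//.
  by rewrite exprD ler_pM ?padic_norm_ge0.
by have /andP[r0 /ltW r1] := rho01; rewrite ler_wiXn2l.
Qed.

Lemma padic_exp0 : padic_exp (0 : C) = 1.
Proof.
apply/eqP; rewrite -subr_eq0 -padic_norm_eq0 eq_le padic_norm_ge0 andbT.
by rewrite -[leRHS](padic_norm0 C) padic_exp_sub1_le// padic_norm0.
Qed.

Lemma padic_expX z k : norm z < rad -> padic_exp (k%:R * z) = padic_exp z ^+ k.
Proof.
move=> zr; elim: k => [|k IH]; first by rewrite mul0r padic_exp0.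
rewrite -natr1 mulrDl mul1r padic_expD ?IH ?exprSr//.
by rewrite padic_normM (le_lt_trans _ zr)// ler_piMl ?padic_norm_ge0 ?padic_norm_nat_le1.
Qed.

(** * The p-adic logarithm and its limit formula *)

Let log_term_le z k : norm (log_term z k) <= norm (z - 1) * (norm (z - 1) / rad) ^+ k.
Proof.
rewrite /log_term -mulrA padic_normM padic_normX padic_normN padic_norm1 expr1n mul1r.
by apply: scaled_term_le; exact: exp_radius_nat.
Qed.

Lemma padic_log_cvg z : norm (z - 1) < rad ->
  norm_cvg norm (series (log_term z)) (padic_log z).
Proof.
move=> zr.
have [|l zl] := @geo_series_cvg R p C (log_term z) (norm (z - 1)) _ (norm_ratio_lt1 zr).
  by move=> k; exact: log_term_le.
by rewrite /padic_log (norm_limE zl).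
Qed.

(** The linear term z - 1 strictly dominates the rest of the series, so it determines the norm. The
    case z = 1, where strictness fails, is treated first. *)
Lemma padic_norm_log z : norm (z - 1) < rad -> norm (padic_log z) = norm (z - 1).
Proof.
move=> zr; have /andP[r0 r1] := norm_ratio_lt1 zr.
have [z1|z1] := eqVneq (norm (z - 1)) 0.
  apply/eqP; rewrite z1 eq_le padic_norm_ge0 andbT -[padic_log z]subr0.
  have -> : 0 = series (log_term z) 0 by rewrite /series /= big_geq.
  apply: series_tail_le (padic_log_cvg zr) _ => k _.
  by rewrite (le_trans (log_term_le z k))// z1 mul0r.
have lt1 : norm (padic_log z - (z - 1)) < norm (z - 1).
  apply: (@le_lt_trans _ _ (norm (z - 1) * (norm (z - 1) / rad))).
    have -> : z - 1 = series (log_term z) 1.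
      by rewrite /series /= big_nat1 /log_term expr0 expr1 mul1r divr1.
    rewrite {2 3}/series /= big_nat1 {2 3}/log_term expr0 expr1 mul1r divr1.
    apply: series_tail_le (padic_log_cvg zr) _ => -[//|k] _.
    rewrite (le_trans (log_term_le z _))// ler_wpM2l ?padic_norm_ge0//.
    by rewrite exprS ler_piMr// exprn_ile1// ltW.
  by rewrite gtr_pMr// lt_neqAle eq_sym z1 padic_norm_ge0.
apply/eqP; rewrite eq_le; apply/andP; split.
  by rewrite -(subrK (z - 1) (padic_log z)) padic_normD_le// ltW.
rewrite leNgt; apply/negP => lt2.
suff : norm (z - 1) < norm (z - 1) by rewrite ltxx.
rewrite -{1}(subKr (padic_log z) (z - 1)) (le_lt_trans (padic_norm_ultra _ _))//.
by rewrite gt_max lt2 padic_normN.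
Qed.

(** Induction by Pascal's rule C(M-1,k+1) = C(M,k+1) - C(M-1,k): the new error C(M,k+1) = M C(M-1,k)
    / (k+1) has norm at most |M| / |k+1|. *)
Let bin_pred_sub_sign_le M k : (0 < M)%N ->
  norm ('C(M.-1, k)%:R - (-1) ^+ k) <= norm M%:R * k.+1%:R.
Proof.
move=> M0; elim: k => [|k IH].
  by rewrite bin0 expr0 subrr padic_norm0 mulr_ge0 ?padic_norm_ge0.
have binM : 'C(M, k.+1)%:R = 'C(M.-1, k.+1)%:R + 'C(M.-1, k)%:R :> C.
  by case: M M0 {IH} => // M _; rewrite /= -natrD.
have -> : 'C(M.-1, k.+1)%:R - (-1) ^+ k.+1
    = 'C(M, k.+1)%:R - ('C(M.-1, k)%:R - (-1) ^+ k) :> C.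
  by rewrite binM exprS; ring.
apply: padic_normB_le; last first.
  by rewrite (le_trans IH)// ler_wpM2l ?padic_norm_ge0// ler_nat.
have k0 : k.+1%:R != 0 :> C by exact: padic_nat_neq0.
have -> : 'C(M, k.+1)%:R = M%:R * ('C(M.-1, k)%:R / k.+1%:R) :> C.
  by rewrite mulrA -natrM mul_bin_diag natrM mulrAC divff// mul1r.
rewrite padic_normM ler_wpM2l ?padic_norm_ge0// padic_normM padic_normV.
rewrite -[leRHS]mul1r ler_pM ?invr_ge0 ?padic_norm_ge0 ?padic_norm_nat_le1//.
by rewrite (le_trans (padic_norm_natV_le _ _ _))// ler_nat.
Qed.

(** Each of the k+1 terms of 1 + rho + ... + rho^k is at least rho^k. The bound absorbs the linear
    factor of the preceding estimate. *)
Let natM_geo_le (rho : R) k : 0 <= rho < 1 -> k.+1%:R * rho ^+ k <= (1 - rho)^-1.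
Proof.
move=> /andP[r0 r1]; have d0 : 0 < 1 - rho by rewrite subr_gt0.
rewrite -[leRHS]mul1r ler_pdivlMr//.
apply: (@le_trans _ _ ((\sum_(i < k.+1) rho ^+ i) * (1 - rho))).
  have -> : k.+1%:R = \sum_(i < k.+1) 1 :> R by rewrite sumr_const card_ord.
  rewrite ler_wpM2r ?(ltW d0)// mulr_suml.
  apply: ler_sum => i _; rewrite mul1r ler_wiXn2l ?(ltW r1)//.
  by rewrite -ltnS ltn_ord.
by rewrite mulrC -[1 - rho]opprB mulNr -subrX1 opprB gerBl exprn_ge0.
Qed.

(* (z^M - 1) / M = \sum_(k < M) C(M-1, k) (z-1)^(k+1) / (k+1), and
   C(M-1, k) is p-adically close to (-1)^k when M = p^N. *)
Lemma padic_log_powlim z : norm (z - 1) < rad ->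
  norm_cvg norm (fun N => (z ^+ (p ^ N) - 1) / (p ^ N)%:R) (padic_log z).
Proof.
move=> zr; have r01 := norm_ratio_lt1 zr; have /andP[r0 r1] := r01.
apply: norm_cvg_close.
  (* Partial sums of length p^N also converge to the logarithm, so only the difference from them
     must tend to 0. *)
  apply: (norm_cvg_sub (f := expn p) _ (padic_log_cvg zr)) => k.
  exact: ltnW (ltn_expl _ (prime_gt1 p_prime)).
have p01 := invp_itv R p_prime.
apply: (norm_cvg_geo (c := (1 - norm (z - 1) / rad)^-1) p01) => N; rewrite /comp.
set M := (p ^ N)%N; have M0 : (0 < M)%N by rewrite expn_gt0 prime_gt0.
have normM : norm M%:R = p%:R^-1 ^+ N by rewrite natrX padic_normX padic_norm_p.
clearbody M.
have -> : (z ^+ M - 1) / M%:R - series (log_term z) M =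
    \sum_(k < M) ('C(M.-1, k)%:R - (-1) ^+ k) * ((z - 1) ^+ k.+1 / k.+1%:R).
  rewrite /series /= big_mkord.
  have -> : (z ^+ M - 1) / M%:R = \sum_(k < M) 'C(M.-1, k)%:R * ((z - 1) ^+ k.+1 / k.+1%:R).
    rewrite -{1}(subrKC 1 z) exprDn big_ord_recl /= expr0 expr1n bin0 mulr1 mulr1n.
    rewrite addrAC subrr add0r mulr_suml; apply: eq_bigr => k _.
    rewrite expr1n mul1r /bump /= add1n -mulr_natr.
    have k0 : k.+1%:R != 0 :> C by exact: padic_nat_neq0.
    have M1 : M%:R != 0 :> C by exact: padic_nat_neq0.
    have := congr1 (fun n => n%:R : C) (mul_bin_diag M k); rewrite !natrM => h.
    have -> : 'C(M.-1, k)%:R = k.+1%:R * 'C(M, k.+1)%:R / M%:R :> C.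
      by rewrite -h mulrAC divff// mul1r.
    by field; rewrite addrC natr1 k0.
  by rewrite -sumrB; apply: eq_bigr => k _; rewrite mulrBl /log_term -[X in _ - X = _]mulrA.
rewrite padic_norm_sum_le => [//||k _].
  by rewrite mulr_ge0 ?exprn_ge0 ?invr_ge0 ?ler0n ?subr_ge0 ?(ltW r1).
(* The binomial error contributes |M| (k+1) and the power of z - 1 contributes at most ratio^k,
   using |z - 1| <= 1; their product is O(|M|) uniformly in k. *)
rewrite padic_normM (@le_trans _ _ ((norm M%:R * k.+1%:R) * (norm (z - 1) / rad) ^+ k))//.
  rewrite ler_pM ?padic_norm_ge0 ?bin_pred_sub_sign_le//.
  rewrite (le_trans (scaled_term_le _ (exp_radius_nat _ p_prime k)))//.
  by rewrite ler_piMl ?exprn_ge0 ?(le_trans (ltW zr)) ?(ltW (exp_radius_lt1 _ _)).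
by rewrite normM -mulrA mulrC ler_wpM2r ?natM_geo_le// exprn_ge0//.
Qed.

(** The quotients (exp(z)^M - 1) / M with M = p^N are evaluated in two ways; uniqueness of limits
    identifies the results. *)
Lemma padic_expK z : norm z < rad -> padic_log (padic_exp z) = z.
Proof.
move=> zr; apply: norm_cvg_unique (padic_log_powlim _) _.
  exact: le_lt_trans (padic_exp_sub1_le zr) zr.
have p01 := invp_itv R p_prime.
apply: (norm_cvg_close (u := fun=> z)).
  by apply/norm_cvgP => e e0; exists 0%N => k _; rewrite subrr padic_norm0.
apply: (norm_cvg_geo (c := 1) p01) => N; rewrite mul1r.
set M := (p ^ N)%N; have M0 : (0 < M)%N by rewrite expn_gt0 prime_gt0.
have normM : norm M%:R = p%:R^-1 ^+ N by rewrite natrX padic_normX padic_norm_p.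
clearbody M.
have M1 : M%:R != 0 :> C by exact: padic_nat_neq0.
have -> : (padic_exp z ^+ M - 1) / M%:R - z = (padic_exp (M%:R * z) - 1 - M%:R * z) / M%:R.
  by rewrite padic_expX//; field.
rewrite padic_normM padic_normV ler_pdivrMr ?padic_norm_nat_gt0// -normM -expr2.
by rewrite padic_exp_scale_le ?padic_norm_nat_le1.
Qed.

End PadicExpLog.

(** * Carlitz q-Bernoulli numbers *)

Section CarlitzClosedForm.
Variables (R : realType) (p : nat) (C : padicComplex R p).
Implicit Types (Q q a x : C) (k l r s : nat).

(** Up to the sign, this is (j+1) / [j+1]_Q, the q-integral of Q^(jy): the limit of the sums of
    Q^((j+1)y) over y < p^N, divided by [p^N]_Q. *)
Definition carlitz_coef Q j : C := (-1) ^+ j * j.+1%:R * ((1 - Q) / (1 - Q ^+ j.+1)).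

(** The recursion has at most one solution, so an explicit solution must be the one chosen by
    [xget]. The hypotheses on [qpow] are those later checked for Q = q^W. *)
Lemma carlitz_numE Q k :
  (forall l, qpow Q l%:R = Q ^+ l) -> (forall l, Q ^+ l.+1 != 1) ->
  carlitz_num Q k = (1 - Q) ^- k * \sum_(j < k.+1) 'C(k, j)%:R * carlitz_coef Q j.
Proof.
move=> QE Q1.
pose b k := (1 - Q) ^- k * \sum_(j < k.+1) 'C(k, j)%:R * carlitz_coef Q j.
have Q1n l : 1 - Q ^+ l.+1 != 0 by rewrite subr_eq0 eq_sym.
have Q10 : 1 - Q != 0 by have := Q1n 0%N; rewrite expr1.
(* After [sum_bin_transform] with Q + (1 - Q) = 1, the factor Q^(j+1) - 1 cancels the denominator of
   [carlitz_coef], and [sum_bin_sign] evaluates what remains. *)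
have bspec : carlitz_spec Q b.
  split; first by rewrite /b big_ord1 /carlitz_coef expr0 expr1 divff// invr1 bin0 !mulr1.
  case=> // m _; have {1}-> : \sum_(l < m.+2) 'C(m.+1, l)%:R * qpow Q l%:R * b l =
      (1 - Q) ^- m.+1 * \sum_(l < m.+2) 'C(m.+1, l)%:R * Q ^+ l
        * (1 - Q) ^+ (m.+1 - l) * \sum_(j < l.+1) 'C(l, j)%:R * carlitz_coef Q j.
    rewrite mulr_sumr; apply: eq_bigr => -[l /= lm] _.
    rewrite QE expfB_cond; last by rewrite (negbTE Q10) -ltnS.
    rewrite /b; set S := \sum_(_ < _) _; move: (1 - Q) Q10 S => z z0 S.
    by field; rewrite !expf_neq0.
  rewrite sum_bin_transform subrKC mulrCA -mulrBr [Q * _]mulr_sumr -sumrB.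
  transitivity ((1 - Q) ^- m.+1 * (- (1 - Q) *
      \sum_(j < m.+2) 'C(m.+1, j)%:R * (-1) ^+ j * j.+1%:R)); last first.
    rewrite sum_bin_sign mulrN mulNr opprK eqSS.
    by case: m => [|m]; rewrite ?mulr0// mulr1 expr1 mulVf.
  congr (_ * _); rewrite mulr_sumr; apply: eq_bigr => j _.
  rewrite expr1n mulr1 /carlitz_coef exprS.
  have := Q1n j; rewrite exprS => h; by field.
have [c0 cS] : carlitz_spec Q (carlitz_num Q) by apply: xgetPex; exists b.
have [b0 bS] := bspec.
(* In the recursion of index k+1 the unknown has the nonzero coefficient Q^(k+2) - 1, so it is
   determined by the earlier values. *)
rewrite -/(b k); elim/ltn_ind: k => -[|k] IH; first by rewrite c0 b0.
have := cS k.+1 isT; rewrite -(bS k.+1 isT).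
rewrite ![\sum_(l < k.+2) _]big_ord_recr /= binn mul1r (QE k.+1).
under eq_bigr => l _ do rewrite IH ?ltn_ord//.
set S := \sum_(_ < _) _ => h.
apply: (mulfI (Q1n k.+1)).
have {}h : (Q * Q ^+ k.+1 - 1) * carlitz_num Q k.+1 = (Q * Q ^+ k.+1 - 1) * b k.+1.
  by apply: (addrI (Q * S)); move: h; rewrite !mulrDr !mulrBl !mul1r !addrA !mulrA.
by rewrite exprS -opprB !mulNr h.
Qed.

(** The powers of 1 - Q in the closed form and in [a]_Q combine to degree k, and [sum_bin_transform]
    applies with Q^a + (1 - Q^a) = 1. *)
Lemma carlitz_polyE Q a k :
  (forall l, qpow Q l%:R = Q ^+ l) -> (forall l, Q ^+ l.+1 != 1) ->
  (forall l, qpow Q (l%:R * a) = qpow Q a ^+ l) ->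
  carlitz_poly k Q a = (1 - Q) ^- k *
    \sum_(j < k.+1) 'C(k, j)%:R * (carlitz_coef Q j * qpow Q a ^+ j).
Proof.
move=> QE Q1 aE; have Q10 : 1 - Q != 0 by rewrite subr_eq0 eq_sym (Q1 0%N).
transitivity ((1 - Q) ^- k * \sum_(l < k.+1) 'C(k, l)%:R * qpow Q a ^+ l
        * (1 - qpow Q a) ^+ (k - l) * \sum_(j < l.+1) 'C(l, j)%:R * carlitz_coef Q j).
  rewrite mulr_sumr; apply: eq_bigr => -[l /= lk] _.
  rewrite carlitz_numE// aE /qnum expr_div_n.
  have -> : (1 - Q) ^- k = (1 - Q) ^- l * (1 - Q) ^- (k - l) :> C.
    by rewrite -invfM -exprD subnKC.
  by ring.
rewrite sum_bin_transform subrKC; congr (_ * _); apply: eq_bigr => j _.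
by rewrite expr1n mulr1 !mulrA.
Qed.

End CarlitzClosedForm.

(** * Symmetry under permutation of the weights *)

Section Symmetry.
Variables (R : realType) (p : nat) (C : padicComplex R p) (q x : C).
Hypotheses (p_prime : prime p) (q_neq1 : q != 1).
Hypotheses (q_near1 : padic_norm (1 - q) < exp_radius R p) (x_le1 : padic_norm x <= 1).

Let q_near1C : padic_norm (q - 1) < exp_radius R p.
Proof. by rewrite padic_norm_distC. Qed.

Let scaled_log_small (a : C) :
  padic_norm a <= 1 -> padic_norm (a * padic_log q) < exp_radius R p.
Proof.
move=> a1; rewrite padic_normM (padic_norm_log p_prime q_near1C).
by rewrite (le_lt_trans _ q_near1C)// ler_piMl ?padic_norm_ge0.
Qed.

(** By [padic_expK], log(q^k) = k log q, which reduces every base q^k to the base q. *)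
Lemma qpow_qpow (k : nat) a : qpow (qpow q k%:R) a = qpow q (k%:R * a).
Proof.
rewrite {1}/qpow [qpow q k%:R]/qpow padic_expK//; last first.
  by rewrite scaled_log_small ?padic_norm_nat_le1.
by rewrite /qpow mulrA [a * _]mulrC.
Qed.

Lemma qpow_mulX (l : nat) a : padic_norm a <= 1 -> qpow q (l%:R * a) = qpow q a ^+ l.
Proof. by move=> a1; rewrite /qpow -mulrA padic_expX// scaled_log_small. Qed.

(** If the power were 1, taking logarithms would give (k+1) log q = 0, whereas |log q| = |q - 1| is
    nonzero. This keeps all denominators below nonzero. *)
Lemma qpow1_exp_neq1 k : qpow q 1 ^+ k.+1 != 1.
Proof.
rewrite -qpow_mulX ?padic_norm1// mulr1; apply/eqP => qk1.
have rad0 : padic_norm (0 : C) < exp_radius R p by rewrite padic_norm0 exp_radius_gt0.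
have : k.+1%:R * padic_log q = 0.
  rewrite -(padic_expK p_prime (scaled_log_small (padic_norm_nat_le1 C k.+1))).
  by rewrite -/(qpow q _) qk1 -(padic_exp0 C p_prime) padic_expK.
move/eqP; rewrite mulf_eq0 (negbTE (padic_nat_neq0 _ p_prime _))//=.
rewrite -padic_norm_eq0 (padic_norm_log p_prime q_near1C) padic_norm_eq0 subr_eq0.
exact/negP.
Qed.

(** Powers of [eps] = exp(log q) carry all natural exponents, while the 1 - q in the denominator of
    [qnum] remains a separate symbol. *)
Let eps := qpow q 1.

Let qpow_nat k : qpow q k%:R = eps ^+ k.
Proof. by rewrite -[k%:R]mulr1 qpow_mulX ?padic_norm1. Qed.

Let eps_neq1 k : (0 < k)%N -> 1 - eps ^+ k != 0.
Proof. by case: k => // k _; rewrite subr_eq0 eq_sym qpow1_exp_neq1. Qed.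

Let qpow_qpow_nat k l : qpow (qpow q k%:R) l%:R = eps ^+ (k * l).
Proof. by rewrite qpow_qpow -natrM qpow_nat. Qed.

Let wsum n (v : 'I_n -> nat) (k : {dffun forall j : 'I_n, 'I_(v j)}) :=
  (\sum_(j < n) (\prod_(h < n | h != j) v h) * k j)%N.

(* The sum over s collapses by the binomial theorem since y + (1 - y) = 1 for
   y = eps ^+ (wn * wsum k). *)
Lemma carlitz_sum_inner n (v : 'I_n -> nat) wn r :
  (forall j, 0 < v j)%N -> (0 < wn)%N ->
  let W := (\prod_(j < n) v j)%N in
  \sum_(s < r.+1) 'C(r, s)%:R * qnum q W%:R ^ (s%:Z - 1) * qnum q wn%:R ^+ (r - s)
    * carlitz_poly s (qpow q W%:R) (wn%:R * x)
    * qK (qpow q wn%:R) v (r - s) s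
  = (1 - q) * (1 - q) ^- r * \sum_(l < r.+1) 'C(r, l)%:R * (-1) ^+ l * l.+1%:R
     * qpow q ((W * wn)%:R * x) ^+ l
     * ((1 - eps ^+ (W * l.+1))^-1
        * \sum_(k : {dffun forall j : 'I_n, 'I_(v j)}) eps ^+ (wn * l.+1 * wsum k)).
Proof.
move=> v0 wn0 W; have W0 : (0 < W)%N by rewrite prodn_gt0.
have q0 : 1 - q != 0 by rewrite subr_eq0 eq_sym.
set X := qpow q ((W * wn)%:R * x).
(* [f] is [carlitz_coef] at Q = [eps ^+ W] times X^j, without the factor 1 - Q, which goes to cancel
   against [W]_q^(s-1). *)
pose f j := (-1) ^+ j * j.+1%:R / (1 - eps ^+ (W * j.+1)) * X ^+ j.
transitivity (\sum_(s < r.+1) (1 - q) * (1 - q) ^- r *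
   \sum_(k : {dffun forall j : 'I_n, 'I_(v j)}) (eps ^+ (wn * wsum k)) *
   ('C(r, s)%:R * (eps ^+ (wn * wsum k)) ^+ s * (1 - eps ^+ (wn * wsum k)) ^+ (r - s)
   * (\sum_(j < s.+1) 'C(s, j)%:R * f j))).
  apply: eq_bigr => -[s /= sr] _.
  rewrite carlitz_polyE; first last.
  - move=> l; rewrite !qpow_qpow -/X.
    have -> : W%:R * (l%:R * (wn%:R * x)) = l%:R * ((W * wn)%:R * x) by rewrite natrM; ring.
    rewrite qpow_mulX; first by congr (qpow _ _ ^+ _); rewrite natrM; ring.
    by rewrite padic_normM mulr_ile1 ?padic_norm_ge0 ?padic_norm_nat_le1.
  - by move=> l; rewrite qpow_nat -exprM -subr_eq0 -oppr_eq0 opprB eps_neq1 ?muln_gt0 ?W0.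
  - by move=> l; rewrite qpow_qpow_nat qpow_nat exprM.
  rewrite (qpow_qpow W (wn%:R * x)) [W%:R * _]mulrA -natrM -/X (qpow_nat W) /qK.
  have -> : \sum_(j < s.+1) 'C(s, j)%:R * (carlitz_coef (eps ^+ W) j * X ^+ j)
     = (1 - eps ^+ W) * \sum_(j < s.+1) 'C(s, j)%:R * f j.
    rewrite mulr_sumr; apply: eq_bigr => j _; rewrite /carlitz_coef /f -exprM.
    by ring.
  move: (\sum_(j < s.+1) _) => S; rewrite !mulr_sumr; apply: eq_bigr => k _.
  rewrite -/(wsum k) /qnum !qpow_qpow_nat !qpow_nat.
  have eW := eps_neq1 W0; have ew := eps_neq1 wn0.
  (* Of the s+1 copies of the exponent, one is the outer weight y and the other s form y^s for the
     binomial sum. *)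
  have -> : (wn * (s.+1 * wsum k) = wn * wsum k + wn * wsum k * s)%N by lia.
  rewrite exprD -exprM; set y := eps ^+ (wn * wsum k).
  rewrite expfzDr; last by rewrite mulf_neq0// invr_eq0.
  rewrite exprN1 -exprnP !expr_div_n.
  have -> : (1 - q) ^- r = (1 - q) ^- s * (1 - q) ^- (r - s) :> C.
    by rewrite -invfM -exprD subnKC.
  (* All powers of 1 - [eps ^+ W] and 1 - [eps ^+ wn] cancel, leaving (1-q)^(1-r), which is
     independent of s. *)
  by field; rewrite !expf_neq0 ?eW ?ew ?q0.
rewrite -mulr_sumr exchange_big /=; congr (_ * _).
under eq_bigr do rewrite -mulr_sumr sum_bin_transform subrKC.
under eq_bigr do rewrite mulr_sumr.
rewrite exchange_big; apply: eq_bigr => l _; rewrite !mulr_sumr; apply: eq_bigr => k _.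
have -> : (wn * l.+1 * wsum k = wn * wsum k + wn * wsum k * l)%N by lia.
by rewrite expr1n mulr1 /f exprD -exprM; ring.
Qed.

(** The exponent is linear in k, so the sum factors into geometric sums. The j-th has v_j terms and
    ratio [eps ^+ d j], and d_j v_j is the same for all j, so all numerators agree. *)
Lemma sum_eps_wsum n (v : 'I_n -> nat) c :
  (forall j, 0 < v j)%N -> (0 < c)%N ->
  \sum_(k : {dffun forall j : 'I_n, 'I_(v j)}) eps ^+ (c * wsum k)
  = \prod_(j < n) ((1 - eps ^+ (c * \prod_(h < n) v h))
                   / (1 - eps ^+ (c * \prod_(h < n | h != j) v h))).
Proof.
move=> v0 c0.
pose d j := (c * \prod_(h < n | h != j) v h)%N.
transitivity (\sum_(k : {dffun forall j : 'I_n, 'I_(v j)}) \prod_j eps ^+ (d j * k j)).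
  apply: eq_bigr => k _; rewrite /wsum big_distrr /= -prodrXr.
  by apply: eq_bigr => j _; rewrite mulnA.
rewrite (big_distr_dffun (fun j (i : 'I_(v j)) => eps ^+ (d j * i))).
apply: eq_bigr => j _; rewrite -/(d j).
have dj : 1 - eps ^+ d j != 0.
  by rewrite eps_neq1// muln_gt0 c0 prodn_cond_gt0.
apply: (canRL (mulfK dj)); rewrite mulrC.
have -> : (c * \prod_(h < n) v h = d j * v j)%N by rewrite (bigD1 j)//= mulnCA mulnC.
rewrite exprM -[RHS]opprB subrX1 -mulNr opprB; congr (_ * _).
by apply: eq_bigr => i _; rewrite exprM.
Qed.

(** The geometric sums give the denominators that omit one of the first n permuted weights; the
    separate factor with W omits the last one. Together they form a product over all indices, free
    of sigma. *)
Lemma carlitz_sum_inner_perm n (w : 'I_n.+1 -> nat) l (sigma : 'S_n.+1) :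
  (forall j, 0 < w j)%N ->
  let v := fun j : 'I_n => w (sigma (widen_ord (leqnSn n) j)) in
  let W := (\prod_(j < n) v j)%N in
  (1 - eps ^+ (W * l.+1))^-1
    * \sum_(k : {dffun forall j : 'I_n, 'I_(v j)}) eps ^+ (w (sigma ord_max) * l.+1 * wsum k)
  = (1 - eps ^+ (l.+1 * \prod_j w j)) ^+ n
    / \prod_j (1 - eps ^+ (l.+1 * \prod_(h | h != j) w h)).
Proof.
move=> w0 v W; rewrite sum_eps_wsum ?muln_gt0 ?w0// => [|j]; last exact: w0.
have prodw Q (F := fun j => w (sigma j)) :
  (\prod_(h < n.+1 | Q (sigma h)) F h = \prod_(h | Q h) w h)%N.
  by rewrite [RHS](reindex_inj (@perm_inj _ sigma)).
have PE : (\prod_j w j = W * w (sigma ord_max))%N.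
  by rewrite -(prodw predT) big_ord_recr.
(* [cmax] and [cwid] split a product omitting one weight according to whether the last permuted
   weight is the omitted one. *)
have cmax : (\prod_(h | h != sigma ord_max) w h = W)%N.
  rewrite -(prodw (fun h => h != sigma ord_max)) /= big_mkcond big_ord_recr /= eqxx muln1.
  apply: eq_bigr => j _; rewrite (inj_eq perm_inj) ifT//.
  by rewrite -val_eqE /= neq_ltn ltn_ord.
have cwid (j : 'I_n) : (\prod_(h | h != sigma (widen_ord (leqnSn n) j)) w h
    = \prod_(h < n | h != j) v h * w (sigma ord_max))%N.
  rewrite -(prodw (fun h => h != sigma (widen_ord (leqnSn n) j))) /= big_mkcond big_ord_recr /=.
  rewrite (inj_eq perm_inj) ifT; last by rewrite -val_eqE /= neq_ltn ltn_ord orbT.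
  congr (_ * _)%N; rewrite [RHS]big_mkcond; apply: eq_bigr => h _.
  by rewrite (inj_eq perm_inj).
rewrite [X in _ = _ / X](reindex_inj (@perm_inj _ sigma)) [X in _ = _ / X]big_ord_recr /= cmax PE.
rewrite big_split /= prodr_const card_ord invfM mulrCA [X in _ * X]mulrC.
congr (_ ^+ _ * (_ * _)).
- by congr (1 - _ ^+ _); rewrite -/W; lia.
- by rewrite prodfV; congr (_^-1); apply: eq_bigr => j _; rewrite cwid; congr (1 - _ ^+ _);
  rewrite -mulnA mulnCA [(w _ * _)%N]mulnC.
- by rewrite mulnC.
Qed.

Lemma carlitz_sum_perm n (w : 'I_n.+1 -> nat) m lambda (sigma tau : 'S_n.+1) :
  (forall j, 0 < w j)%N ->
  carlitz_sum w m q lambda x sigma = carlitz_sum w m q lambda x tau.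
Proof.
move=> w0.
(* It suffices to reach an expression in which the permutation no longer occurs. *)
suff E (rho : 'S_n.+1) : carlitz_sum w m q lambda x rho =
    \sum_(r < m.+1) (stirling1 m r)%:~R * lambda ^+ (m - r) * ((1 - q) * (1 - q) ^- r *
      \sum_(l < r.+1) 'C(r, l)%:R * (-1) ^+ l * l.+1%:R * qpow q ((\prod_j w j)%:R * x) ^+ l
      * ((1 - eps ^+ (l.+1 * \prod_j w j)) ^+ n
         / \prod_j (1 - eps ^+ (l.+1 * \prod_(h | h != j) w h)))) by rewrite !E.
apply: eq_bigr => r _.
set v := fun j : 'I_n => w (rho (widen_ord (leqnSn n) j)).
have PE : (\prod_j w j = \prod_(j < n) v j * w (rho ord_max))%N.
  by rewrite (reindex_inj (@perm_inj _ rho)) big_ord_recr.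
transitivity ((stirling1 m r)%:~R * lambda ^+ (m - r) *
    \sum_(s < r.+1) 'C(r, s)%:R * qnum q (\prod_(j < n) v j)%N%:R ^ (s%:Z - 1)
      * qnum q (w (rho ord_max))%:R ^+ (r - s)
      * carlitz_poly s (qpow q (\prod_(j < n) v j)%N%:R) ((w (rho ord_max))%:R * x)
      * qK (qpow q (w (rho ord_max))%:R) v (r - s) s).
  by rewrite mulr_sumr; apply: eq_bigr => s _; rewrite -/v; ring.
rewrite carlitz_sum_inner// => [|j]; last exact: w0.
congr (_ * (_ * _)); apply: eq_bigr => l _.
by rewrite carlitz_sum_inner_perm// PE.
Qed.

End Symmetry.

Theorem theorem2p3 (R : realType) (p : nat) (hp : prime p) (hodd : odd p)
    (C : padicComplex R p)
    (q : C) (hq1 : q != 1)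
    (hq : padic_norm (1 - q) < (p%:R : R) `^ (- (p%:R - 1)^-1))
    (lambda : C) (hl0 : lambda != 0) (hl1 : padic_norm lambda <= 1)
    (n : nat) (w : 'I_n.+1 -> nat) (hw : forall j, (0 < w j)%N)
    (m : nat) (x : C) (hx : padic_int padic_norm x) :
  forall sigma tau : 'S_n.+1,
    carlitz_sum w m q lambda x sigma = carlitz_sum w m q lambda x tau.
Proof.
(* The hypothesis on q is the bound by [exp_radius] written out, and x in Z_p enters through |x| <=
   1. *)
move=> sigma tau; apply: carlitz_sum_perm => //; exact: padic_int_norm_le1.
Qed.
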